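(* For $\alpha\in(0,1]$, let $$\pi_\alpha:\widetilde\Sigma_\alpha\to\Omega_\alpha,\qquad (x,y,\sigma)\mapsto\left(x,\ \frac{y}{1-xy}\right).$$ Then $\pi_\alpha$ is a $2:1$ surjection, and $\pi_\alpha\circ\Phi_\alpha=\mathcal T_\alpha\circ\pi_\alpha$, where $\Phi_\alpha:\widetilde\Sigma_\alpha\to\widetilde\Sigma_\alpha$ is the map $(x,y,\sigma)\mapsto(T_\alpha(x),\ \varepsilon(x)\,x(1-xy),\ -\varepsilon(x)\sigma)$.
   Context: **$\alpha$-continued fractions.** For $\alpha\in(0,1]$ let $\mathbb I_\alpha=[\alpha-1,\alpha]$ and define $T_\alpha:\mathbb I_\alpha\to\mathbb I_\alpha$ by $T_\alpha(x)=\left|\frac1x\right|-\left\lfloor\left|\frac1x\right|+1-\alpha\right\rfloor$ for $x\ne0$, $T_\alpha(0)=0$. Put $\varepsilon(x)=1$ if $x\ge0$, $\varepsilon(x)=-1$ if $x<0$, and $d_\alpha(x)=\left\lfloor\left|\frac1x\right|+1-\alpha\right\rfloor$ (with $d_\alpha(0)=\infty$). Define $\mathcal T_\alpha(x,y)=\left(T_\alpha(x),\frac{1}{d_\alpha(x)+\varepsilon(x)y}\right)$ for $x\in\mathbb I_\alpha$, $y\in[0,1]$, and let $\Omega_\alpha$ be the closure of the union of the $\mathcal T_\alpha$-orbits of the points $(x,0)$, $x\in\mathbb I_\alpha$. **The set $\widetilde\Sigma_\alpha$.** Let $\mathcal Z(x,y)=(x,\,y/(1+xy))$ for $xy\neq-1$,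 and $\Sigma_\alpha=\mathcal Z(\Omega_\alpha)\subset\mathbb R^2$. For $(x,y)\in\mathbb R^2$ let $$A_{-1}(x,y)=\begin{pmatrix}1&y\\-x&1-xy\end{pmatrix},\qquad A_{+1}(x,y)=\begin{pmatrix}x&1-xy\\-1&y\end{pmatrix}.$$ For $\sigma\in\{-1,+1\}$ let $\widetilde\Sigma_{\alpha,\sigma}$ be the set of classes in $\mathrm{PSL}_2(\mathbb Z)\backslash\mathrm{PSL}_2(\mathbb R)$ represented by $A_\sigma(x,y)$ with $(x,y)\in\Sigma_\alpha$, and let $\widetilde\Sigma_\alpha=\widetilde\Sigma_{\alpha,-1}\cup\widetilde\Sigma_{\alpha,+1}$. The class of $A_\sigma(x,y)$ is denoted $(x,y,\sigma)$; this labelling is unambiguous for almost every point with respect to the measure induced by Lebesgue measure $dx\,dy$ on $\Sigma_\alpha$. Statements about maps on $\widetilde\Sigma_\alpha$ are understood almost everywhere. *)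

(* Defs.v *)
From HB Require Import structures.
From mathcomp Require Import all_boot all_order all_algebra generic_quotient.
From mathcomp Require Import all_classical all_reals all_analysis.
From mathcomp Require Import ring.

Set Implicit Arguments.
Unset Strict Implicit.
Unset Printing Implicit Defensive.

Import Order.TTheory GRing.Theory Num.Theory.
Import numFieldNormedType.Exports.
Local Open Scope classical_set_scope.
Local Open Scope ring_scope.
Local Open Scope quotient_scope.

Section AlphaContinuedFractions.
Variables (R : realType) (alpha : R).

Definition cf_sign (x : R) : int := if 0 <= x then 1 else -1.

(* [x^-1] is [0] at [x = 0]; the convention d(0) = oo is implemented in [cfT]
   and [cf_natext]. *)
Definition cf_digit (x : R) : int := Num.floor (`|x^-1| + 1 - alpha).

Definition cfT (x : R) : R :=
  if x == 0 then 0 else `|x^-1| - (cf_digit x)%:~R.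

Definition cf_natext (p : R * R) : R * R :=
  if p.1 == 0 then (0, 0)
  else (cfT p.1, ((cf_digit p.1)%:~R + (cf_sign p.1)%:~R * p.2)^-1).

Definition Omega : set (R * R) :=
  closure (\bigcup_n (iter n cf_natext
    @` [set p : R * R | alpha - 1 <= p.1 <= alpha /\ p.2 = 0])).

Definition cf_Z (p : R * R) : R * R := (p.1, p.2 / (1 + p.1 * p.2)).

Definition Sigma : set (R * R) := cf_Z @` Omega.

End AlphaContinuedFractions.

Section ModularQuotient.
Variable R : realType.

Definition mx22 (T : Type) (a b c d : T) : 'M[T]_2 :=
  \matrix_(i < 2, j < 2)
    if i == ord0 then (if j == ord0 then a else b)
    else (if j == ord0 then c else d).

Lemma det_mx22 (T : comNzRingType) (a b c d : T) :
  \det (mx22 a b c d) = a * d - b * c.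
Proof.
rewrite (expand_det_row _ ord0) !big_ord_recl big_ord0 /cofactor !det_mx11.
rewrite !mxE /= /bump /= expr0 expr1; ring.
Qed.

Definition SL2 := {M : 'M[R]_2 | \det M == 1}.

(* M and N in SL_2(R) lie in the same class iff [N] = [g][M] in PSL_2(R) for
   some g in SL_2(Z). *)
Definition modular_eq (M N : SL2) : bool :=
  `[< exists g : 'M[int]_2, \det g = 1 /\
      (val N = map_mx intr g *m val M \/ val N = - (map_mx intr g *m val M)) >].

Lemma modular_eq_refl : reflexive modular_eq.
Proof.
move=> M; apply/asboolP; exists 1%:M; split; first exact: det1.
by left; rewrite map_mx1 mul1mx.
Qed.

Lemma modular_eq_symW M N : modular_eq M N -> modular_eq N M.
Proof.
move=> /asboolP[g [g1 MN]]; apply/asboolP; exists (\adj g).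
have adjK : map_mx intr (\adj g) *m map_mx intr g = 1%:M :> 'M[R]_2.
  by rewrite -map_mxM mul_adj_mx g1 map_mx1.
split.
  have /(congr1 determinant) := mul_adj_mx g.
  by rewrite det_mulmx g1 mulr1 det1.
by case: MN => ->; [left|right]; rewrite ?mulmxN ?opprK mulmxA adjK mul1mx.
Qed.

Lemma modular_eq_sym : symmetric modular_eq.
Proof. by move=> M N; apply/idP/idP; exact: modular_eq_symW. Qed.

Lemma modular_eq_trans : transitive modular_eq.
Proof.
move=> N M P /asboolP[g [g1 MN]] /asboolP[h [h1 NP]]; apply/asboolP.
exists (h *m g); split; first by rewrite det_mulmx g1 h1 mulr1.
rewrite map_mxM -mulmxA.
by case: NP => ->; case: MN => ->; rewrite ?mulmxN ?opprK; auto.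
Qed.

Canonical modular_equiv :=
  EquivRel modular_eq modular_eq_refl modular_eq_sym modular_eq_trans.

(* PSL_2(Z) \ PSL_2(R) *)
Definition modular_quotient := {eq_quot modular_equiv}.

Definition A_mx (x y : R) (sigma : int) : 'M[R]_2 :=
  if sigma == 1 then mx22 x (1 - x * y) (-1) y
  else mx22 1 y (- x) (1 - x * y).

Lemma det_A_mx x y sigma : \det (A_mx x y sigma) == 1.
Proof. by rewrite /A_mx; case: ifP => _; rewrite det_mx22; apply/eqP; ring. Qed.

(* A label (x, y, sigma) parses as ((x, y), sigma). *)
Definition label : Type := (R * R * int)%type.

Definition class_of_label (l : label) : modular_quotient :=
  let: (x, y, sigma) := l in
  \pi_modular_quotient (Sub (A_mx x y sigma) (det_A_mx x y sigma) : SL2).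

End ModularQuotient.

Section CrossSection.
Variables (R : realType) (alpha : R).

Definition labels : set (label R) :=
  [set l | Sigma alpha l.1 /\ (l.2 = -1 \/ l.2 = 1)].

Definition Sigmat_sign (sigma : int) : set (modular_quotient R) :=
  [set class_of_label (p, sigma) | p in Sigma alpha].

Definition Sigmat : set (modular_quotient R) :=
  Sigmat_sign (-1) `|` Sigmat_sign 1.

Definition pi_label (l : label R) : R * R :=
  let: (x, y, _) := l in (x, y / (1 - x * y)).

Definition Phi_label (l : label R) : label R :=
  let: (x, y, sigma) := l in
  (cfT alpha x, (cf_sign x)%:~R * x * (1 - x * y), - cf_sign x * sigma).

Definition labels_of (c : modular_quotient R) : set (label R) :=
  [set l | labels l /\ class_of_label l = c].

Definition unambiguous (c : modular_quotient R) : Prop :=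
  exists! l, labels_of c l.

(* At the (negligible) classes with several labels an arbitrary one is used;
   off [Sigmat] the value is junk. *)
Definition label_of (c : modular_quotient R) : label R :=
  xget (0, 0, 1) (labels_of c).

Definition pi_alpha (c : modular_quotient R) : R * R := pi_label (label_of c).

Definition Phi_alpha (c : modular_quotient R) : modular_quotient R :=
  class_of_label (Phi_label (label_of c)).

Definition lebesgue2 := (@lebesgue_measure R \x @lebesgue_measure R)%E.

Definition ae_in (D : set (R * R)) (P : R * R -> Prop) : Prop :=
  {ae lebesgue2, forall p, D p -> P p}.

(* Almost everywhere for the measure induced on [Sigmat] by dx dy on [Sigma]:
   a set of classes is null iff, for each sign, its trace on [Sigma] is. *)
Definition ae_Sigmat (P : modular_quotient R -> Prop) : Prop :=
  forall sigma : int, sigma = -1 \/ sigma = 1 ->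
    ae_in (Sigma alpha) (fun p => P (class_of_label (p, sigma))).

End CrossSection.

(* Main.v *)
(* Write v = y / (1 - x y). Two labels of one class differ by an integral matrix;
   comparing first columns, for irrational x, this matrix either translates x by
   an integer, which is impossible when x is interior to the interval of length
   one, or negates y, which is impossible since y >= 0. So a class is ambiguous
   only if x is rational or an endpoint, or y = 0. Moreover T_alpha is locally a
   smooth branch off a countable set of x, where the natural extension is
   continuous and therefore maps the closure Omega into itself. All exceptional
   points lie on countably many vertical lines and on one horizontal line, and
   the conjugacy itself is an algebraic identity. *)
Require Import Defs.
From mathcomp Require Import all_boot all_order all_algebra generic_quotient.
From mathcomp Require Import all_classical all_reals all_analysis.
From mathcomp Require Import finmap ring lra zify.
Import Order.TTheory GRing.Theory Num.Theory.
Import numFieldNormedType.Exports.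
Local Open Scope classical_set_scope.
Local Open Scope ring_scope.

Lemma card_set2_I2 (T : choiceType) (x y : T) : x != y ->
  ([set x; y] #= `I_2)%card.
Proof.
move=> xy; have -> : [set x; y] = [set` [fset x; y]%fset].
  by apply/seteqP; split=> z; rewrite /= !inE; [case=> ->|case/orP=> /eqP ->];
    rewrite ?eqxx ?orbT; auto.
by apply/card_eq_fsetP; rewrite cardfs2 xy.
Qed.

Section AlphaCrossSection.
Variables (R : realType) (alpha : R).
Hypothesis alpha01 : 0 < alpha <= 1.

(** * Irrational and generic points *)

Lemma irrational_lin_eq0 (x : R) (a b : int) :
  irrational x -> a%:~R + b%:~R * x = 0 -> b = 0.
Proof.
move=> xI abx; apply/eqP/negPn/negP => b0; apply: xI.
exists (- a%:~R / b%:~R) => //.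
have b0R : b%:~R != 0 :> R by rewrite intr_eq0.
rewrite fmorph_div rmorphN /= !ratr_int; apply: (mulIf b0R).
by rewrite divfK//; lra.
Qed.

Lemma irrational_neq0 (x : R) : irrational x -> x != 0.
Proof. by apply: contra_notN => /eqP ->; exists 0 => //; rewrite rmorph0. Qed.

Lemma irrational_neq_int (x : R) (n : int) : irrational x -> x != n%:~R.
Proof. by apply: contra_notN => /eqP ->; exists n%:~R => //; rewrite ratr_int. Qed.

(** The second condition keeps [x] off both endpoints [alpha - 1] and [alpha]; the third keeps
    [|1/x| + 1 - alpha] off the integers, where the digit jumps. *)
Definition cf_generic : set R :=
  [set x | [/\ irrational x, irrational (x - alpha)
             & irrational (`|x^-1| - alpha)]].

(** Solving each failed condition for [x] leaves four values per rational [q]. *)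
Lemma countable_not_cf_generic : countable (~` cf_generic).
Proof.
have : countable (\bigcup_(q in [set: rat])
    [set ratr q; ratr q + alpha; (ratr q + alpha)^-1; - (ratr q + alpha)^-1]).
  apply: bigcup_countable => // q _; apply: finite_set_countable.
  by rewrite !finite_setU; do !split; exact: finite_set1.
apply: sub_countable; apply: subset_card_le => x /=.
rewrite /cf_generic /= => /not_and3P[] /contrapT [q _ qx]; exists q => //.
- by rewrite -qx; do 3 left.
- by do 2 left; right; rewrite qx subrK.
- rewrite qx subrK; have [x0|x0] := leP 0 x.
    by left; right; rewrite ger0_norm ?invr_ge0// invrK.
  by right; rewrite /= ltr0_norm ?invr_lt0// invrN invrK opprK.
Qed.

(** * A closed box containing [Omega], and invariance of [Omega] at generic points *)

Lemma cfT_bounds (x : R) : x != 0 -> alpha - 1 <= cfT alpha x < alpha.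
Proof.
move=> x0; rewrite /cfT (negPf x0) /cf_digit.
have := floor_itv (`|x^-1| + 1 - alpha); rewrite intrD; lra.
Qed.

Lemma cf_signE (x : R) : (cf_sign x)%:~R = (if 0 <= x then 1 else -1) :> R.
Proof. by rewrite /cf_sign; case: ifP. Qed.

(** For [x > 0], [alpha * x <= 1] makes the digit at least 1. For [x < 0], [1 - alpha ^ 2 <= 1]
    makes it at least 2, which absorbs the subtracted [v <= 1]. Hence the second coordinate stays in
    [[0, 1]]. *)
Lemma cf_denom_ge1 (x v : R) : x != 0 -> alpha - 1 <= x <= alpha ->
  0 <= v <= 1 -> 1 <= (cf_digit alpha x)%:~R + (cf_sign x)%:~R * v.
Proof.
move=> x0 xI vI; rewrite cf_signE.
suff : (if 0 <= x then 1 else 2) <= (cf_digit alpha x)%:~R :> R.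
  by case: ifP => _; lra.
have -> : (if 0 <= x then 1 else 2) = (if 0 <= x then 1 else 2 : int)%:~R :> R.
  by case: ifP.
rewrite ler_int /cf_digit floor_ge_int; case: ifPn => [x_ge0|]; last first.
  rewrite -ltNge => x_lt0; rewrite ltr0_norm ?invr_lt0// -invrN.
  suff : 1 + alpha <= (- x)^-1 by lra.
  rewrite -[_^-1]mul1r ler_pdivlMr ?oppr_gt0//.
  have /andP[a0 a1] := alpha01; have /andP[x1 x2] := xI; nra.
rewrite ger0_norm ?invr_ge0//; suff : alpha <= x^-1 by lra.
have x_gt0 : 0 < x by rewrite lt_neqAle eq_sym x0.
rewrite -[_^-1]mul1r ler_pdivlMr//.
have /andP[a0 a1] := alpha01; have /andP[x1 x2] := xI; nra.
Qed.

Definition cf_box : set (R * R) :=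
  [set p | alpha - 1 <= p.1 <= alpha /\ 0 <= p.2 <= 1].

Lemma closed_cf_box : closed cf_box.
Proof.
have cfst : continuous (@fst R R) by move=> ?; exact: cvg_fst.
have csnd : continuous (@snd R R) by move=> ?; exact: cvg_snd.
have -> : cf_box = [set p : R * R | alpha - 1 <= p.1] `&` [set p | p.1 <= alpha]
    `&` ([set p | 0 <= p.2] `&` [set p | p.2 <= 1]).
  by apply/seteqP; split=> p /=; rewrite /cf_box /=;
    [move=> [/andP[-> ->] /andP[-> ->]]|move=> [[-> ->] [-> ->]]].
do !apply: closedI.
- by apply: (preimage_closed (D := [set x | alpha - 1 <= x]));
    [move=> ? _; exact: cfst|exact: closed_ge].
- by apply: (preimage_closed (D := [set x | x <= alpha]));
    [move=> ? _; exact: cfst|exact: closed_le].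
- - by apply: (preimage_closed (f := @snd R R) (D := [set x | 0 <= x]));
    [move=> ? _; exact: csnd|exact: closed_ge].
- by apply: (preimage_closed (f := @snd R R) (D := [set x | x <= 1]));
    [move=> ? _; exact: csnd|exact: closed_le].
Qed.

Lemma cf_natext_box (p : R * R) : cf_box p -> cf_box (cf_natext alpha p).
Proof.
move=> [xI vI]; rewrite /cf_natext; case: ifPn => [_|x0].
  by rewrite /cf_box /=; split; have := alpha01; lra.
have := cfT_bounds _ x0; have := cf_denom_ge1 _ _ x0 xI vI.
rewrite /cf_box /= => d1 /andP[-> /ltW ->]; split=> //.
by rewrite invr_ge0 (le_trans ler01)//= invf_le1// (lt_le_trans ltr01).
Qed.

Lemma Omega_box (p : R * R) : Omega alpha p -> cf_box p.
Proof.
suff /closureS : (\bigcup_n (iter n (cf_natext alpha)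
    @` [set p : R * R | alpha - 1 <= p.1 <= alpha /\ p.2 = 0])) `<=` cf_box.
  by move=> sub /sub; rewrite -(iffLR (closure_id _) closed_cf_box).
move=> _ [n _ [q [xI v0] <-]]; elim: n => [|n IHn] /=; last exact: cf_natext_box.
by split=> //; rewrite v0; lra.
Qed.

(* At a generic point the digit and the sign are locally constant, so that the
   natural extension is continuous there and preserves the closure. *)
Lemma cf_natext_cvg (p : R * R) : cf_generic p.1 -> cf_box p ->
  cf_natext alpha q @[q --> p] --> cf_natext alpha p.
Proof.
case: p => x v [/= x_irr _ digit_irr] [/= xI vI].
have x0 := irrational_neq0 _ x_irr.
have d1 := cf_denom_ge1 _ _ x0 xI vI.
have cx : q.1 @[q --> (x, v)] --> x by exact: cvg_fst.
have cv : q.2 @[q --> (x, v)] --> v by exact: cvg_snd.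
have cn : `|q.1^-1| @[q --> (x, v)] --> `|x^-1|.
  by apply: cvg_norm; exact: cvgV.
(* [G] freezes the digit and the sign at their values for [x]; it is continuous at [(x, v)] and
   agrees with the natural extension nearby. *)
pose G (q : R * R) := (`|q.1^-1| - (cf_digit alpha x)%:~R,
  ((cf_digit alpha x)%:~R + (cf_sign x)%:~R * q.2)^-1).
have -> : cf_natext alpha (x, v) = G (x, v).
  by rewrite /cf_natext /cfT /= (negPf x0).
have near_digit : \forall q \near (x, v), cf_digit alpha q.1 = cf_digit alpha x.
  have [lo hi] : (cf_digit alpha x)%:~R < `|x^-1| + 1 - alpha /\
      `|x^-1| + 1 - alpha < (cf_digit alpha x + 1)%:~R.
    have /andP[lo hi] := floor_itv (`|x^-1| + 1 - alpha); split=> //.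
    (* Equality would make [|1/x| - alpha] the integer [cf_digit alpha x - 1]. *)
    rewrite lt_neqAle lo andbT eq_sym.
    have := irrational_neq_int _ (cf_digit alpha x - 1) digit_irr.
    rewrite /cf_digit intrB; apply: contra => /eqP; lra.
  have c : `|q.1^-1| + 1 - alpha @[q --> (x, v)] --> `|x^-1| + 1 - alpha.
    by apply: cvgB; [apply: cvgD => //|]; exact: cvg_cst.
  near=> q; apply: floor_def; apply/andP; split; first apply: ltW.
    by near: q; exact: (cvgr_gt _ c).
  by near: q; exact: (cvgr_lt _ c).
have near_sign : \forall q \near (x, v), cf_sign q.1 = cf_sign x.
  rewrite /cf_sign; have [x_ge0|x_lt0] := leP 0 x.
    have x_gt0 : 0 < x by rewrite lt_neqAle eq_sym x0.
    by near=> q; rewrite ifT// ltW//; near: q; exact: (cvgr_gt _ cx).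
  near=> q; rewrite ifF//; apply/negbTE; rewrite -ltNge; near: q.
  exact: (cvgr_lt _ cx).
apply: (@cvg_trans _ (G q @[q --> (x, v)])).
  apply: near_eq_cvg; near=> q; rewrite /cf_natext /cfT /G ifF; last first.
    apply/negbTE; near: q; apply: (cvgr_neq0 _ cx) => //.
  rewrite ifF; last by apply/negbTE; near: q; apply: (cvgr_neq0 _ cx).
  suff [-> ->] : cf_digit alpha q.1 = cf_digit alpha x /\ cf_sign q.1 = cf_sign x.
    by [].
  by split; near: q.
have c1 : `|q.1^-1| - (cf_digit alpha x)%:~R @[q --> (x, v)] -->
    `|x^-1| - (cf_digit alpha x)%:~R by apply: cvgB => //; exact: cvg_cst.
have c2 : ((cf_digit alpha x)%:~R + (cf_sign x)%:~R * q.2)^-1 @[q --> (x, v)] -->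
    ((cf_digit alpha x)%:~R + (cf_sign x)%:~R * v)^-1.
  apply: cvgV; first by rewrite gt_eqF// (lt_le_trans ltr01).
  by apply: cvgD; [exact: cvg_cst|apply: cvgM => //; exact: cvg_cst].
exact: (cvg_pair c1 c2).
Unshelve. all: by end_near. Qed.

Lemma cf_natext_Omega (p : R * R) : cf_generic p.1 -> Omega alpha p ->
  Omega alpha (cf_natext alpha p).
Proof.
move=> pG pO U /(cf_natext_cvg _ pG (Omega_box _ pO)) /pO.
(* An orbit point close to [p] is sent into [U], and its image is the next point of the same
   orbit. *)
move=> [_ [[n _ [q qI <-]] Uq]]; exists (cf_natext alpha (iter n (cf_natext alpha) q)).
by split=> //; exists n.+1 => //; exists q.
Qed.

(** * Coordinates on [Sigma] and on [Omega] *)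

Lemma cf_box_denom_gt0 (x v : R) : cf_box (x, v) -> 0 < 1 + x * v.
Proof.
move: alpha01 => /andP[a0 a1] [/= /andP[x1 x2] /andP[v0 v1]].
(* Adding this product to the next one gives [alpha <= 1 + x * v]. *)
have : 0 <= v * (x - (alpha - 1)) by apply: mulr_ge0; lra.
by have : 0 <= (1 - v) * (1 - alpha) by [apply: mulr_ge0; lra]; lra.
Qed.

(** With [v = y / (1 - x * y)], the map [cf_Z] is inverted through [1 - x * y = (1 + x * v)^-1],
    which is positive on the box. *)
Lemma SigmaP (x y : R) : Sigma alpha (x, y) <->
  0 < 1 - x * y /\ Omega alpha (x, y / (1 - x * y)).
Proof.
have denomE (v : R) : 1 + x * v != 0 -> 1 - x * (v / (1 + x * v)) = (1 + x * v)^-1.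
  by move=> ?; field.
split=> [[[x' v] pO [xx' vy]]|[xy_gt0 pO]]; last first.
  exists (x, y / (1 - x * y)) => //; congr pair.
  have e : 1 + x * (y / (1 - x * y)) = (1 - x * y)^-1 by field; rewrite gt_eqF.
  by rewrite /= e invrK divfK// gt_eqF.
move: xx' vy pO => /= -> <- pO; have [/= xI vI] := Omega_box _ pO.
have d_gt0 := cf_box_denom_gt0 _ _ (Omega_box _ pO).
by rewrite denomE ?gt_eqF// invr_gt0 d_gt0 invrK divfK ?gt_eqF.
Qed.

(** * Labels of one class *)

Lemma det_mx2 (T : comNzRingType) (g : 'M[T]_2) :
  \det g = g ord0 ord0 * g ord_max ord_max - g ord0 ord_max * g ord_max ord0.
Proof.
rewrite -det_mx22; congr (\det _); apply/matrixP => i j; rewrite mxE.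
by case: ifPn => i0; case: ifPn => j0; congr (g _ _); apply/val_inj;
  move: i j i0 j0 => [[|[|//]] ?] [[|[|//]] ?].
Qed.

(* In dimension 2 the sign of PSL_2 can be absorbed in the integral matrix. *)
Lemma class_of_label_eq (x y x' y' : R) (s s' : int) :
  class_of_label (x, y, s) = class_of_label (x', y', s') ->
  exists a b c d : int, let A := A_mx x y s in let A' := A_mx x' y' s' in
  [/\ a * d - b * c = 1,
    forall j, A' ord0 j = a%:~R * A ord0 j + b%:~R * A ord_max j &
    forall j, A' ord_max j = c%:~R * A ord0 j + d%:~R * A ord_max j].
Proof.
move=> /eqmodP/asboolP[g [g1 gA]]; move: g1; rewrite det_mx2 => g1.
have entry i j : (map_mx intr g *m A_mx x y s) i j =
    (g i ord0)%:~R * A_mx x y s ord0 j + (g i ord_max)%:~R * A_mx x y s ord_max j.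
  rewrite mxE big_ord_recr big_ord1 ![map_mx _ _ _ _]mxE.
  by have -> : widen_ord (leqnSn 1) ord0 = ord0 by apply/val_inj.
have /= [->|->] := gA.
  exists (g ord0 ord0), (g ord0 ord_max), (g ord_max ord0), (g ord_max ord_max).
  by split.
exists (- g ord0 ord0), (- g ord0 ord_max), (- g ord_max ord0), (- g ord_max ord_max).
by split=> [|j|j]; rewrite ?mulrNN// mxE entry !intrN !mulNr opprD.
Qed.

Lemma A_mxE (x y : R) (s : int) : s = -1 \/ s = 1 ->
  [/\ A_mx x y s ord0 ord0 = if s == 1 then x else 1,
      A_mx x y s ord0 ord_max = if s == 1 then 1 - x * y else y,
      A_mx x y s ord_max ord0 = if s == 1 then -1 else - x &
      A_mx x y s ord_max ord_max = if s == 1 then y else 1 - x * y].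
Proof. by rewrite /A_mx /mx22; case=> ->; rewrite /= !mxE. Qed.

(* The first columns of the representatives are [(x, -1)] and [(1, - x)], so an
   irrational [x] determines the integral matrix relating two labels of a class:
   either it translates [x] by an integer, or it changes the sign of [y]. *)
Lemma class_of_label_inj (x y x' y' : R) (s s' : int) :
  s = -1 \/ s = 1 -> s' = -1 \/ s' = 1 ->
  irrational x -> alpha - 1 < x < alpha -> alpha - 1 <= x' <= alpha ->
  0 < y -> 0 <= y' -> class_of_label (x, y, s) = class_of_label (x', y', s') ->
  (x, y, s) = (x', y', s').
Proof.
move=> sE s'E xirr xI x'I y0 y'0 /class_of_label_eq[a [b [c [d]]]] /=.
have [A00 A01 A10 A11] := A_mxE x y _ sE.
have [B00 B01 B10 B11] := A_mxE x' y' _ s'E.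
move=> [det1 r0 r1].
move: (r0 ord0) (r0 ord_max) (r1 ord0) (r1 ord_max).
rewrite {r0 r1} A00 A01 A10 A11 B00 B01 B10 B11 {A00 A01 A10 A11 B00 B01 B10 B11}.
(* [x] is interior and [x'] lies in the same closed interval of length one, so their distance is
   less than 1. *)
have small (n : int) : x' = x - n%:~R -> n = 0.
  move=> x'E; have : `|n%:~R| < 1%:~R :> R by rewrite ltr_norml; lra.
  by rewrite -intr_norm ltr_int; lia.
have int_inj (m n : int) : m%:~R = n%:~R :> R -> m = n by move/intr_inj.
case: sE s'E => -> [] -> /= e00 e01 e10 e11.
- have b0 : - b = 0 by apply: (@irrational_lin_eq0 x (a - 1)) => //;
    rewrite intrB intrN; lra.
  have {}b0 : b = 0 by lia.
  subst b; have a1 : a = 1 by apply: int_inj; lra.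
  subst a; have d1 : d = 1 by lia.
  subst d; have c0 := small c; have {}c0 : c = 0 by apply: c0; lra.
  by subst c; congr (_, _, _); lra.
- have d0 : - d = 0 by apply: (@irrational_lin_eq0 x (c + 1)) => //;
    rewrite intrD intrN; lra.
  have {}d0 : d = 0 by lia.
  subst d; have c1 : c = -1 by apply: int_inj; lra.
  (* For opposite signs the second column now reads [y' = - y], against [0 < y] and [0 <= y']. *)
  by exfalso; subst c; lra.
- have a0 : a = 0 by apply: (@irrational_lin_eq0 x (- b - 1)) => //;
    rewrite intrB intrN; lra.
  subst a; have b1 : b = -1 by apply: int_inj; lra.
  by exfalso; subst b; lra.
- have c0 : c = 0 by apply: (@irrational_lin_eq0 x (1 - d)) => //;
    rewrite intrB; lra.
  subst c; have d1 : d = 1 by apply: int_inj; lra.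
  subst d; have a1 : a = 1 by lia.
  subst a; have b0 := small b; have {}b0 : b = 0 by apply: b0; lra.
  by subst b; congr (_, _, _); lra.
Qed.

(** * Regular labels and the projection to [Omega] *)

Lemma Sigma_bounds (p : R * R) : Sigma alpha p ->
  alpha - 1 <= p.1 <= alpha /\ 0 <= p.2.
Proof.
case: p => x y /(SigmaP _ _)[xy_gt0 /(Omega_box _)[/= xI /andP[v0 _]]].
by split=> //=; move: v0; rewrite pmulr_lge0// invr_gt0.
Qed.

(** The conditions that [class_of_label_inj] asks of its first label; they persist under [Phi_label]
    at generic points. *)
Definition regular_label (l : label R) : Prop :=
  [/\ labels alpha l, irrational l.1.1, alpha - 1 < l.1.1 < alpha & 0 < l.1.2].

(** Only one label has to be regular: the competing [l'] is arbitrary, as uniqueness among all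
    labels of the class demands. *)
Lemma labels_of_regular (l l' : label R) : regular_label l ->
  labels_of alpha (class_of_label l) l' -> l' = l.
Proof.
case: l l' => [[x y] s] [[x' y'] s'] [/= [_ sE] xirr xI y0] [[/= pS s'E] /esym e].
have [/= x'I y'0] := Sigma_bounds _ pS.
by rewrite (class_of_label_inj x y x' y' s s').
Qed.

Lemma regular_label_unambiguous (l : label R) : regular_label l ->
  unambiguous alpha (class_of_label l).
Proof.
move=> lR; exists l; split; first by case: lR.
by move=> l' /(labels_of_regular _ _ lR).
Qed.

Lemma label_ofK (l : label R) : regular_label l ->
  label_of alpha (class_of_label l) = l.
Proof.
move=> lR; apply: labels_of_regular => //; apply: xgetPex.
by exists l; split=> //; case: lR.
Qed.

Lemma Sigmat_class (l : label R) : labels alpha l ->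
  Sigmat alpha (class_of_label l).
Proof. by case: l => p s [/= pS [->|->]]; [left|right]; exists p. Qed.

Lemma label_of_labels (c : modular_quotient R) : Sigmat alpha c ->
  labels_of alpha c (label_of alpha c).
Proof.
move=> cS; apply: xgetPex.
by case: cS => -[p pS <-]; eexists (p, _); split=> //; split=> //; [left|right].
Qed.

Lemma pi_label_Omega (l : label R) : labels alpha l -> Omega alpha (pi_label l).
Proof. by case: l => [[x y] s] [/= /(SigmaP _ _)[]]. Qed.

Lemma cf_Z_pi_label (l : label R) : labels alpha l -> cf_Z (pi_label l) = l.1.
Proof.
case: l => [[x y] s] [/= /(SigmaP _ _)[xy_gt0 _] _].
rewrite /cf_Z /=; congr pair; have xy0 : 1 - x * y != 0 by rewrite gt_eqF.
have -> : 1 + x * (y / (1 - x * y)) = (1 - x * y)^-1 by field.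
by rewrite invrK divfK.
Qed.

Lemma pi_label_cf_Z (p : R * R) (s : int) : Omega alpha p ->
  pi_label (cf_Z p, s) = p.
Proof.
case: p => x v /(Omega_box _)[/= xI vI]; congr pair.
have xv0 : 1 + x * v != 0 by rewrite gt_eqF// (cf_box_denom_gt0 _ _ (conj xI vI)).
have -> : 1 - x * (v / (1 + x * v)) = (1 + x * v)^-1 by field.
by rewrite invrK divfK.
Qed.

(** * The conjugacy identity and invariance of regular labels *)

(** Since [|1/x|] is the sign over [x] and the sign squares to 1, the new [1 - x * y] factors as the
    new [y] times the denominator of the natural extension. Dividing gives the conjugacy. *)
Lemma cfT_denomE (x y : R) : x != 0 -> 1 - x * y != 0 ->
  1 - cfT alpha x * ((cf_sign x)%:~R * x * (1 - x * y)) =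
  (cf_sign x)%:~R * x * (1 - x * y) *
    ((cf_digit alpha x)%:~R + (cf_sign x)%:~R * (y / (1 - x * y))).
Proof.
move=> x0 xy0; rewrite cf_signE /cfT (negPf x0).
have -> : `|x^-1| = (if 0 <= x then 1 else -1) / x.
  case: ifPn => [x_ge0|]; first by rewrite ger0_norm ?invr_ge0// mul1r.
  by rewrite -ltNge => x_lt0; rewrite ltr0_norm ?invr_lt0// mulN1r.
by case: ifP => _; field; rewrite ?xy0 ?x0.
Qed.

Lemma pi_label_Phi (l : label R) : l.1.1 != 0 -> 1 - l.1.1 * l.1.2 != 0 ->
  pi_label (Phi_label alpha l) = cf_natext alpha (pi_label l).
Proof.
case: l => [[x y] s] /= x0 xy0; rewrite /cf_natext /= (negPf x0); congr pair.
rewrite cfT_denomE// -[RHS]div1r invfM mulrA divff// !mulf_neq0//.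
by rewrite /cf_sign; case: ifP.
Qed.

(** A rational value [q] would give [x = e / (q + d)] with [e] the sign and [d] the digit. *)
Lemma irrational_cfT (x : R) : irrational x -> irrational (cfT alpha x).
Proof.
move=> xirr; have x0 := irrational_neq0 _ xirr.
have [e e2 xE] : exists2 e : int, e != 0 & `|x^-1| = e%:~R / x.
  have [x_ge0|x_lt0] := leP 0 x; [exists 1|exists (-1)] => //.
    by rewrite ger0_norm ?invr_ge0// mul1r.
  by rewrite ltr0_norm ?invr_lt0// mulN1r.
apply: contra_not xirr => -[q _]; rewrite /cfT (negPf x0) xE => qE.
exists (e%:~R / (q + (cf_digit alpha x)%:~R)) => //.
rewrite fmorph_div rmorphD /= !ratr_int qE subrK invf_div mulrC divfK//.
by rewrite intr_eq0.
Qed.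

(** Membership in [Sigma] is read off in [Omega]: there the image is the natural extension of a
    point of [Omega] over a generic [x]. *)
Lemma regular_Phi (l : label R) : regular_label l -> cf_generic l.1.1 ->
  regular_label (Phi_label alpha l).
Proof.
move=> [lS xirr xI y0] xG; have x0 := irrational_neq0 _ xirr.
have xy_gt0 : 0 < 1 - l.1.1 * l.1.2.
  by case: l lS {xirr xI y0 xG x0} => [[x y] s] [/= /(SigmaP _ _)[]].
have := cf_natext_Omega (pi_label l).
rewrite -pi_label_Phi ?(gt_eqF xy_gt0)//.
case: l lS xirr xI y0 xG x0 xy_gt0 => [[x y] s] lS xirr xI y0 xG x0 xy_gt0.
move=> /(_ xG (pi_label_Omega _ lS)) pO.
have y'_gt0 : 0 < (cf_sign x)%:~R * x * (1 - x * y).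
  apply: mulr_gt0 => //; rewrite cf_signE; case: ifPn => [x_ge0|].
    by rewrite mul1r lt_neqAle eq_sym x0.
  by rewrite -ltNge mulN1r oppr_gt0.
have /andP[T1 T2] := cfT_bounds _ x0.
split=> //=.
- split=> /=; last by case: lS => /= _ [->|->]; rewrite /cf_sign; case: ifP; auto.
  apply/SigmaP => //; split=> //.
  rewrite cfT_denomE ?(gt_eqF xy_gt0)//; apply: mulr_gt0 => //.
  have [? ?] := Omega_box _ (pi_label_Omega _ lS).
  by rewrite (lt_le_trans ltr01)// cf_denom_ge1.
- exact: irrational_cfT.
(* The value [alpha - 1] would again make [|1/x| - alpha] an integer. *)
- rewrite T2 lt_neqAle T1 !andbT eq_sym /cfT (negPf x0).
  have [_ _ digit_irr] := xG.
  have := irrational_neq_int _ (cf_digit alpha x - 1) digit_irr.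
  by apply: contra => /eqP; rewrite intrB /=; lra.
Qed.

(** * Almost everywhere statements and fibers *)

Lemma ae_in_cf_generic (D : set (R * R)) (P : R * R -> Prop) :
  (forall p, D p -> cf_generic p.1 -> p.2 != 0 -> P p) -> ae_in D P.
Proof.
move=> DP; rewrite /ae_in /lebesgue2.
have mC : measurable (~` cf_generic : set R).
  by apply: countable_measurable; [exact: measurable_set1|exact: countable_not_cf_generic].
have : (lebesgue_measure \x lebesgue_measure)%E.-negligible
    ((~` cf_generic) `*` [set: R] `|` [set: R] `*` [set 0]).
  (* Each of the two products has a countable, hence null, factor, and [0 * +oo = 0] in the product
     measure. *)
  apply: negligibleU; apply/negligibleP.
  - exact: measurableX.
  - apply: etrans; first exact: product_measure1E.
    rewrite [X in (X * _)%E]countable_lebesgue_measure0 ?mul0e//.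
    exact: countable_not_cf_generic.
  - exact: measurableX.
  - apply: etrans; first exact: product_measure1E.
    by rewrite [X in (_ * X)%E]countable_lebesgue_measure0 ?mule0.
apply: negligibleS => p /= /not_implyP[pD nP].
have [pG|nG] := pselect (cf_generic p.1); last by left.
right; split=> //=; apply: contrapT => /eqP p0; apply: nP; exact: DP.
Qed.

Lemma regular_label_generic (p : R * R) (s : int) : s = -1 \/ s = 1 ->
  Sigma alpha p -> cf_generic p.1 -> p.2 != 0 -> regular_label (p, s).
Proof.
move=> sE pS pG p2; have [/andP[x1 x2] y0] := Sigma_bounds _ pS.
have [xirr xalpha _] := pG; split=> //=.
  rewrite !lt_neqAle x1 x2 !andbT; apply/andP; split.
    have := irrational_neq_int _ (-1) xalpha; apply: contra => /eqP; lra.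
  have := irrational_neq_int _ 0 xalpha; apply: contra => /eqP; lra.
by rewrite lt_neqAle eq_sym p2.
Qed.

(** A label over [p] must have coordinates [cf_Z p], so only its sign is free. *)
Lemma fiber_pi_alpha (p : R * R) : (forall s, s = -1 \/ s = 1 ->
    regular_label (cf_Z p, s)) -> Omega alpha p ->
  (Sigmat alpha `&` pi_alpha alpha @^-1` [set p] #= `I_2)%card.
Proof.
move=> Zreg pO; have reg_m := Zreg _ (or_introl erefl).
have reg_p := Zreg _ (or_intror erefl).
pose cl s := class_of_label (cf_Z p, s).
have -> : Sigmat alpha `&` pi_alpha alpha @^-1` [set p] = [set cl (-1); cl 1].
  apply/seteqP; split=> [c [cS cp]|c].
    have {cp} : pi_label (label_of alpha c) = p := cp.
    have [] := label_of_labels _ cS; case: (label_of alpha c) => q s lS <- qp.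
    have <- : cf_Z p = q by rewrite -qp cf_Z_pi_label.
    by case: lS => /= _ [->|->]; [left|right].
  case=> ->; split.
  - by apply: Sigmat_class; case: reg_m.
  - by rewrite /preimage /mkset /pi_alpha label_ofK// pi_label_cf_Z.
  - by apply: Sigmat_class; case: reg_p.
  - by rewrite /preimage /mkset /pi_alpha label_ofK// pi_label_cf_Z.
(* The two classes differ because [label_of] recovers the sign of a regular label. *)
apply: card_set2_I2; apply/eqP => /(congr1 (label_of alpha)).
by rewrite !label_ofK// => /(congr1 snd).
Qed.
End AlphaCrossSection.

Theorem lemma4p2 (R : realType) (alpha : R) (alpha01 : 0 < alpha <= 1) :
  [/\ ae_Sigmat alpha (fun c =>
        [/\ unambiguous alpha c,
            Omega alpha (pi_alpha alpha c),
            Sigmat alpha (Phi_alpha alpha c) &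
            unambiguous alpha (Phi_alpha alpha c)]),
      [set pi_label l | l in labels alpha] = Omega alpha,
      ae_in (Omega alpha) (fun p =>
        (Sigmat alpha `&` pi_alpha alpha @^-1` [set p] #= `I_2)%card) &
      ae_Sigmat alpha (fun c =>
        pi_alpha alpha (Phi_alpha alpha c) =
        cf_natext alpha (pi_alpha alpha c))].
Proof.
split.
- move=> s sE; apply: (ae_in_cf_generic _ alpha) => p pS pG p2.
  have pR := regular_label_generic _ _ alpha01 _ _ sE pS pG p2.
  have PhiR := regular_Phi _ _ alpha01 _ pR pG.
  rewrite /pi_alpha /Phi_alpha (label_ofK _ _ alpha01)//; split.
  + exact: regular_label_unambiguous.
  + by apply: pi_label_Omega => //; case: pR.
  + by apply: Sigmat_class; case: PhiR.
  + exact: regular_label_unambiguous.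
- apply/seteqP; split=> [_ [l lS <-]|p pO]; first exact: pi_label_Omega.
  (* Surjectivity on labels holds at every point; either sign would serve. *)
  by exists (cf_Z p, 1); [split; [exists p|right]|exact: (pi_label_cf_Z _ _ alpha01)].
- apply: (ae_in_cf_generic _ alpha) => p pO pG p2.
  apply: fiber_pi_alpha => // s sE; apply: regular_label_generic => //.
    by exists p.
  (* The second coordinate of [cf_Z (x, v)] is [v / (1 + x * v)], nonzero because [v] is. *)
  case: p pO pG p2 => x v pO pG v0; rewrite mulf_neq0// invr_neq0// gt_eqF//=.
  exact/(cf_box_denom_gt0 _ _ alpha01)/Omega_box.
- move=> s sE; apply: (ae_in_cf_generic _ alpha) => p pS pG p2.
  have pR := regular_label_generic _ _ alpha01 _ _ sE pS pG p2.
  have PhiR := regular_Phi _ _ alpha01 _ pR pG.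
  rewrite /pi_alpha /Phi_alpha !(label_ofK _ _ alpha01)// pi_label_Phi//=.
    by apply: irrational_neq0; case: pG.
  by rewrite gt_eqF//; case: p pS {pG p2 pR PhiR} => x y /(SigmaP _ _ alpha01)[].
Qed.
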